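(* Let $\kappa$ be an infinite cardinal. Then the following assertions are equivalent: (i) $\kappa$ is strongly compact. (ii) Every discrete space admits a functorial $\kappa$-Lindelöfification.
   Context: All topological spaces are assumed to be completely regular and Hausdorff. A space is $\kappa$-Lindelöf if every open covering $\mathcal{U}$ of it has a subcovering $\mathcal{V}\subset\mathcal{U}$ with $|\mathcal{V}|<\kappa$. A space $X$ admits a functorial $\kappa$-Lindelöfification if there exist a $\kappa$-Lindelöf space $\nu X$ and a continuous map $i_X:X\to\nu X$ such that for every $\kappa$-Lindelöf space $Y$ and every continuous map $f:X\to Y$ there is a unique continuous map $\tilde f:\nu X\to Y$ with $f=\tilde f\circ i_X$. A filter $U$ on a set is $\kappa$-complete if $\bigcap U_0\in U$ for every $U_0\subset U$ with $|U_0|<\kappa$. A cardinal $\kappa$ is called strongly compact (in this statement, without requiring uncountability) if for every set $S$, every $\kappa$-complete (proper) filter over $S$ can be extended to a $\kappa$-complete ultrafilter over $S$. *)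

(* Defs.v *)
From mathcomp Require Import all_boot all_order all_algebra.
From mathcomp Require Import all_classical.
From mathcomp Require Import topology normedtype.

Set Implicit Arguments.
Unset Strict Implicit.
Unset Printing Implicit Defensive.

Local Open Scope classical_set_scope.
Local Open Scope card_scope.

Definition card_lt T U (A : set T) (B : set U) : Prop :=
  (A #<= B) /\ ~ (B #<= A).

(* A cardinal kappa is given by a type K with |K| = kappa; every notion below
   depends on K only through its cardinality. *)

Definition tychonoff_space (X : topologicalType) : Prop :=
  completely_regular_space X /\ hausdorff_space X.

Definition kappa_complete (K : Type) (S : Type) (F : set_system S) : Prop :=
  forall U0 : set (set S), U0 `<=` F -> card_lt U0 [set: K] ->
    F (\bigcap_(A in U0) A).

(* Uncountability of K is not required. UltraFilter includes properness. *)
Definition strongly_compact (K : Type) : Prop :=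
  forall (S : Type) (F : set_system S), ProperFilter F -> kappa_complete K F ->
    exists G : set_system S, [/\ UltraFilter G, kappa_complete K G & F `<=` G].

Definition kappa_lindelof (K : Type) (X : topologicalType) : Prop :=
  forall U : set (set X), (forall A, U A -> open A) ->
    \bigcup_(A in U) A = [set: X] ->
    exists V : set (set X),
      [/\ V `<=` U, \bigcup_(A in V) A = [set: X] & card_lt V [set: K]].

Definition is_functorial_lindelofification (K : Type) (X nuX : topologicalType)
    (i : X -> nuX) : Prop :=
  [/\ tychonoff_space nuX, kappa_lindelof K nuX, continuous i &
      forall Y : topologicalType, tychonoff_space Y -> kappa_lindelof K Y ->
      forall f : X -> Y, continuous f ->
      exists! ft : nuX -> Y, continuous ft /\ f = ft \o i].

Definition admits_functorial_lindelofification (K : Type)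
    (X : topologicalType) : Prop :=
  exists (nuX : topologicalType) (i : X -> nuX),
    is_functorial_lindelofification K i.

(* Main.v *)
Require Import Defs.
From HB Require Import structures.
From mathcomp Require Import all_boot all_order all_algebra.
From mathcomp Require Import all_classical.
From mathcomp Require Import topology normedtype.

Set Implicit Arguments.
Unset Strict Implicit.
Unset Printing Implicit Defensive.

Local Open Scope classical_set_scope.
Local Open Scope card_scope.

(** Let kappa be the cardinality of K.

    From lindelofifications to ultrafilters: let F be a proper kappa-complete
    filter on S, seen as a filter on the discrete space S, and let
    i : S -> nu S be a lindelofification. The image of F in nu S has a cluster
    point p, since otherwise fewer than kappa open sets, each missing a member
    of F, would cover nu S ([kappa_lindelof_cluster]). The trace U on S of the
    neighbourhood filter of p is the required ultrafilter. Every map from S to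
    a discrete space D with fewer than kappa points extends to nu S, so one of
    its fibres belongs to U. For D = bool this says that U is an ultrafilter.
    When D is a family of fewer than kappa members of U, the map sending every
    point outside the intersection to a member avoiding it shows that the
    intersection belongs to U. As p is a cluster point, each member of F meets
    each member of U, so that U contains F.

    From ultrafilters to lindelofifications: nu X is the space of
    kappa-complete ultrafilters on X, in which the sets
    [hat A = {p | A belongs to p}] are a base of clopen sets. If fewer than
    kappa members of a cover by sets [hat A] never suffice, the complements of
    the A generate a proper kappa-complete filter, and a kappa-complete
    ultrafilter extending it is covered by none of them. A map f into a
    kappa-Lindelof space Y sends p to the limit of the image of p under f,
    which exists by the same clustering lemma.

    The generated filter is kappa-complete only if kappa is regular, which is
    part of what has to be proved ([strongly_compact_regular]). If kappa is
    singular, a kappa-complete filter is closed under intersections of kappa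
    members. Extending the filter of sets with small complement on the power
    set of L = seq K to an ultrafilter, one decides every coordinate l in L;
    closure under K-indexed intersections propagates to finite sequences, so
    the point made of all the decisions is itself in the ultrafilter, although
    its complement is in the filter. *)

(** * Comparing cardinals *)

(** A maximal partial injection from A to B is defined on all of A or reaches
    all of B. *)
Lemma card_le_total (T U : Type) (A : set T) (B : set U) : A #<= B \/ B #<= A.
Proof.
pose P := [set R : set (T * U) | [/\ R `<=` A `*` B,
  forall x y y', R (x, y) -> R (x, y') -> y = y' &
  forall x x' y, R (x, y) -> R (x', y) -> x = x'] ].
have [|R [[RAB fR iR] maxR]] := @Zorn_bigcup _ P.
  move=> F FP Ftot; split.
  - by move=> z [R FR Rz]; have [+ _ _] := FP _ FR; apply.
  - move=> x y y' [R FR Rxy] [R' FR' Rxy'].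
    have [_ f1 _] := FP _ FR; have [_ f2 _] := FP _ FR'.
    by have [s|s] := Ftot _ _ FR FR'; [apply: (f2 x) => //|apply: (f1 x) => //];
      exact: s.
  - move=> x x' y [R FR Rxy] [R' FR' Rxy'].
    have [_ _ i1] := FP _ FR; have [_ _ i2] := FP _ FR'.
    by have [s|s] := Ftot _ _ FR FR'; [apply: (i2 _ _ y) => //|
      apply: (i1 _ _ y) => //]; exact: s.
(* a total relation with at most one preimage per value gives an injection *)
have inj (V W : Type) (C : set V) (D : set W) (Q : V -> W -> Prop) :
    (forall x, C x -> exists y, Q x y /\ D y) ->
    (forall x x' y, Q x y -> Q x' y -> x = x') -> C #<= D.
  move=> tot Qi.
  have /choice[f fP] : forall x : C, exists y : D, Q (val x) (val y).
    move=> x; have [y [Qxy Dy]] := tot (val x) (set_valP x).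
    by exists (SigSub (mem_set Dy)).
  apply/card_leP/injfunPex; exists f => // x x' _ _ fxx'.
  by apply/val_inj/(Qi _ _ (val (f x))) => //; rewrite fxx'.
have [domR|ndomR] := pselect (forall x, A x -> exists y, R (x, y)).
  left; apply: (inj _ _ _ _ (fun x y => R (x, y))) => // x Ax.
  by have [y Rxy] := domR x Ax; exists y; split=> //; have [] := RAB _ Rxy.
have [ranR|nranR] := pselect (forall y, B y -> exists x, R (x, y)).
  right; apply: (inj _ _ _ _ (fun y x => R (x, y))) => [y By|y y' x].
    by have [x Rxy] := ranR y By; exists x; split=> //; have [] := RAB _ Rxy.
  exact: fR.
have /existsNP[a /not_implyP[Aa nRa]] := ndomR.
have /existsNP[b /not_implyP[Bb nRb]] := nranR.
exfalso; apply: (maxR (R `|` [set (a, b)])).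
  by split=> [z Rz|s]; [left|apply: nRa; exists b; apply: s; right].
split.
- by move=> z [/RAB//|->].
- move=> x y y' [Rxy|[ex ey]] [Rxy'|[ex' ey']].
  + exact: fR Rxy Rxy'.
  + by case: nRa; exists y; rewrite -ex'.
  + by case: nRa; exists y'; rewrite -ex.
  + by rewrite ey ey'.
- move=> x x' y [Rxy|[ex ey]] [Rxy'|[ex' ey']].
  + exact: iR Rxy Rxy'.
  + by case: nRb; exists x; rewrite -ey'.
  + by case: nRb; exists x'; rewrite -ey.
  + by rewrite ex ex'.
Qed.

Lemma card_le_lt_trans (T U V : Type) (A : set T) (B : set U) (C : set V) :
  A #<= B -> card_lt B C -> card_lt A C.
Proof.
move=> AB [BC nCB]; split; first exact: card_le_trans AB BC.
by move=> CA; apply: nCB; exact: card_le_trans CA AB.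
Qed.

Lemma finite_card_lt (T U : Type) (A : set T) (B : set U) :
  finite_set A -> infinite_set B -> card_lt A B.
Proof.
move=> finA infB; have nBA : ~ (B #<= A) by move=> /card_le_finite /(_ finA).
by split=> //; have [|/nBA] := card_le_total A B.
Qed.

Lemma not_card_lt (T U : Type) (A : set T) (B : set U) :
  ~ card_lt A B -> B #<= A.
Proof.
move=> nAB; have [AB|//] := card_le_total A B.
by apply: contrapT => ?; exact: nAB.
Qed.

(** * Kappa-complete filters *)

Lemma dichotomy_ultra (T : Type) (F : set_system T) :
  ProperFilter F -> (forall A, F A \/ F (~` A)) -> UltraFilter F.
Proof.
move=> PF FP; split=> // G PG FG; apply/seteqP; split=> // A GA.
have [//|FnA] := FP A; exfalso.
apply: (@filter_not_empty _ G); rewrite -(setICr A).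
by apply: filterI => //; exact: FG.
Qed.

Section kappa.
Variables (K : Type) (K_infinite : infinite_set [set: K]).

Lemma kappa_complete_bigcap (S I : Type) (F : set_system S) (D : set I)
    (P : I -> set S) :
  kappa_complete K F -> card_lt D [set: K] -> (forall i, D i -> F (P i)) ->
  F (\bigcap_(i in D) P i).
Proof.
move=> cF ltD FP; rewrite -(bigcap_image D P id).
apply: cF; first by move=> _ [i Di <-]; exact: FP.
exact: card_le_lt_trans (card_image_le _ _) ltD.
Qed.

Lemma kappa_complete_filter (S : Type) (F : set_system S) :
  kappa_complete K F -> (forall A B, A `<=` B -> F A -> F B) -> Filter F.
Proof.
move=> cF upF; split=> //.
- rewrite -(bigcap_set0 (fun A : set S => A)); apply: cF => //.
  exact: finite_card_lt (finite_set0 _) K_infinite.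
- move=> A B FA FB; rewrite -[A](bigcap_set1 id) -[B](bigcap_set1 id).
  rewrite -bigcap_setU; apply: cF; first by move=> _ [] ->.
  by apply: finite_card_lt => //; exact: finite_set2.
Qed.

(** * Strong compactness implies regularity *)

(** [seq K] has the cardinality of K, but that rests on kappa ^ 2 = kappa. What
    the argument needs is only that K copies of [seq K] fit into [seq K], which
    [cons] provides. *)
Lemma bigcup_card_le_seq (S I : pointedType) (D : set I) (F : I -> set S) :
  D #<= [set: K] -> (forall i, D i -> F i #<= [set: seq K]) ->
  \bigcup_(i in D) F i #<= [set: seq K].
Proof.
move=> /pcard_surjP[h hP] FP.
have /choice[f fP] : forall i, exists g : seq K -> S,
    D i -> set_surj setT (F i) g.
  move=> i; have [Di|nDi] := pselect (D i); last by exists (fun=> point).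
  by have /pcard_surjP[g gP] := FP i Di; exists g.
apply/pcard_surjP; exists (fun s => if s is k :: l then f (h k) l else point).
move=> x [i Di Fix]; have [k _ hk] := hP i Di.
by have [l _ fl] := fP i Di x Fix; exists (k :: l) => //; rewrite hk.
Qed.

(** Induction on the length handles the sequences of a given length; the
    lengths themselves form a countable index set, hence are indexed by K. *)
Lemma filter_bigcap_seq (S : Type) (U : set_system S) :
  Filter U ->
  (forall P : K -> set S, (forall k, U (P k)) -> U (\bigcap_k P k)) ->
  forall P : seq K -> set S, (forall l, U (P l)) -> U (\bigcap_l P l).
Proof.
move=> FU UK P UP.
have Un n : forall Q : seq K -> set S, (forall l, U (Q l)) ->
    U (\bigcap_(l in [set l | size l = n]) Q l).
  elim: n => [|n IHn] Q UQ.
    by apply: filterS (UQ [::]) => s Qs [|//] _.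
  have /UK : forall k, U (\bigcap_(l in [set l | size l = n]) Q (k :: l)).
    by move=> k; apply: IHn => l; exact: UQ.
  by apply: filterS => s Qs [//|k l] [sz]; exact: Qs.
have /infiniteP/pcard_surjP[h hP] := K_infinite.
have /UK : forall k, U (\bigcap_(l in [set l | size l = h k]) P l).
  by move=> k; exact: Un.
by apply: filterS => s Ps l _; have [k _ hk] := hP (size l) I; exact: (Ps k).
Qed.

Definition kappa_regular := forall (I T : Type) (D : set I) (F : I -> set T),
  card_lt D [set: K] -> (forall i, D i -> card_lt (F i) [set: K]) ->
  card_lt (\bigcup_(i in D) F i) [set: K].

(** For a singular kappa this is the classical proof that a cardinal carrying a
    nonprincipal complete ultrafilter is a strong limit, applied to a power
    set: an ultrafilter on [seq K -> bool] that decides all coordinates at once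
    is principal. *)
Lemma strongly_compact_regular : strongly_compact K -> kappa_regular.
Proof.
move=> sc I T D F ltD ltF; apply: contrapT => /not_card_lt.
have [k0 _] := infinite_setN0 K_infinite.
pose K' := HB.pack_for pointedType K (gen_eqMixin K) (gen_choiceMixin K)
  (isPointed.Build K k0).
move=> /(@pcard_surjP K')[g gP].
pose S := seq K -> bool.
pose F0 : set_system S := [set A | ~` A #<= [set: seq K]].
have cF0 : kappa_complete K F0.
  move=> U0 U0F [leU0 _]; rewrite /F0 /= setC_bigcap.
  exact: bigcup_card_le_seq.
have FF0 : Filter F0.
  apply: kappa_complete_filter => // A B AB; apply: card_le_trans.
  exact/subset_card_le/subsetC.
have PF0 : ProperFilter F0.
  (* diagonal argument: seq K does not surject onto its power set *)
  split=> //; rewrite /F0 /= setC0 => /pcard_surjP[h hP].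
  have [l _ hl] := hP (fun l => ~~ h l l) Logic.I.
  by have := congr1 (@^~ l) hl; case: (h l l).
have [U [uU cU F0U]] := sc S F0 PF0 cF0.
(* K is the union, over i in the small set D, of the small sets g @` F i *)
have UK P : (forall k : K, U (P k)) -> U (\bigcap_k P k).
  move=> UP.
  have : U (\bigcap_(i in D) \bigcap_(k in g @` F i) P k).
    apply: kappa_complete_bigcap => // i Di; apply: kappa_complete_bigcap => //.
    exact: card_le_lt_trans (card_image_le _ _) (ltF i Di).
  apply: filterS => s Ps k _; have [t [i Di Fit] <-] := gP k Logic.I.
  by apply: (Ps i Di); exists t.
(* b records, for each coordinate, the value chosen by the ultrafilter *)
pose b : S := fun l => `[< U [set s | s l] >].
have Ub l : U [set s | s l = b l].
  rewrite /b; have [Ul|nUl] := pselect (U [set s | s l]).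
    by rewrite asboolT//; apply: filterS Ul => s.
  rewrite asboolF//; have [//|] := in_ultra_setVsetC [set s : S | s l] uU.
  by apply: filterS => s /= /negP/negbTE.
have Ub1 : U [set b].
  apply: filterS (filter_bigcap_seq _ UK Ub) => s sb.
  by apply/funext => l; exact: sb.
have UCb1 : U (~` [set b]).
  apply: F0U; rewrite /F0 /= setCK; apply/pcard_surjP.
  by exists (fun=> b) => _ ->; exists [::].
by apply: (@filter_not_empty _ U); rewrite -(setICr [set b]); exact: filterI.
Qed.

(** * Kappa-Lindelof and Tychonoff spaces *)

(** If no point were a cluster point, the open sets whose complement is in F
    would cover Y; a small subcover gives a small family in F with empty
    intersection. *)
Lemma kappa_lindelof_cluster (Y : topologicalType) (F : set_system Y) :
  kappa_lindelof K Y -> ProperFilter F -> kappa_complete K F ->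
  cluster F !=set0.
Proof.
move=> linY PF cF; apply: contrapT => /nonemptyPn nclF.
pose U := [set O : set Y | open O /\ F (~` O)].
have [O []| |V [VU Vcov ltV]] := linY U; first by [].
  apply/seteqP; split=> // y _; have : ~ cluster F y by rewrite nclF.
  move=> /existsNP[A] /existsNP[B] /not_implyP[FA] /not_implyP[].
  rewrite nbhsE => -[O [oO Oy] OB] /nonemptyPn AB0.
  exists O => //; split=> //; apply: filterS FA => z Az Oz.
  by have : (A `&` B) z by [split=> //; exact: OB]; rewrite AB0.
apply: (@filter_not_empty _ F); rewrite -setCT -Vcov setC_bigcup.
by apply: kappa_complete_bigcap => // O /VU[].
Qed.

Lemma discrete_kappa_lindelof (D : discreteTopologicalType) :
  card_lt [set: D] [set: K] -> kappa_lindelof K D.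
Proof.
move=> ltD U _ Ucov.
have /choice[f fP] : forall d : D, exists A, U A /\ A d.
  move=> d; have [A UA Ad] : (\bigcup_(A in U) A) d by rewrite Ucov.
  by exists A.
exists (range f); split.
- by move=> _ [d _ <-]; have [] := fP d.
- apply/seteqP; split=> // d _; exists (f d); first by exists d.
  by have [] := fP d.
- exact: card_le_lt_trans (card_image_le _ _) ltD.
Qed.
End kappa.

(** The uniformity is the one pulled back from the discrete two-point space by
    the indicator of the clopen set. *)
Lemma clopen_uniform_separator (T : topologicalType) (A B C : set T) :
  clopen C -> A `<=` C -> B `<=` ~` C -> uniform_separator A B.
Proof.
move=> [oC cC] AC BC; pose f (x : T) := `[< C x >].
have fop (W : set bool) : open (f @^-1` W).
  have -> : f @^-1` W = (C `&` (fun=> W true)) `|` (~` C `&` (fun=> W false)).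
    apply/seteqP; split=> x; rewrite /f /=; case: asboolP => Cx.
    - by left.
    - by right.
    - by case=> -[].
    - by case=> -[].
  have open_cst (P : Prop) : open ((fun=> P) : set T).
    by rewrite openE => x p; apply: filterS filterT => y _; exact: p.
  by apply: openU; apply: openI => //; exact: closed_openC.
pose T' : uniformType := initial_topology f.
exists (Uniform.class T'), [set xy | f xy.1 = f xy.2]; split.
- exists [set xy | xy.1 = xy.2] => //.
  by rewrite uniform_discrete => z [b _ <-].
- rewrite -subset0 => -[a b [[/= /AC Ca /BC nCb]]] /=.
  by rewrite /f asboolT// asboolF.
- move=> x U [V [[W oW <- /=]]] Wx /filterS; apply.
  exact: open_nbhs_nbhs.
Qed.

Lemma clopen_base_tychonoff (T : topologicalType) :
  (forall (x : T) (O : set T), open O -> O x ->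
    exists C, [/\ clopen C, C x & C `<=` O]) ->
  hausdorff_space T -> tychonoff_space T.
Proof.
move=> baseT hT; split=> // a B cB nBa.
have [C [coC Ca CB]] := baseT a (~` B) (closed_openC cB) nBa.
apply: (clopen_uniform_separator coC) => [_ ->//|].
by rewrite -(setCK B); exact: subsetC.
Qed.

Lemma discrete_tychonoff (D : discreteTopologicalType) : tychonoff_space D.
Proof.
apply: clopen_base_tychonoff; last exact: discrete_hausdorff.
move=> x O _ Ox; exists [set x]; split=> //; last by move=> _ ->.
by split; [exact: discrete_open|exact: discrete_closed].
Qed.

(** Uniform spaces are regular. The separating uniformity induces a coarser
    topology on T: its neighbourhoods are neighbourhoods in T, and its closures
    contain the closures in T. *)
Lemma tychonoff_regular (T : topologicalType) :
  tychonoff_space T -> regular_space T.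
Proof.
move=> [crT _] x A nA.
have [O [oO Ox] OA] : exists2 O, open_nbhs x O & O `<=` A.
  by move: nA; rewrite nbhsE.
have [] := crT x (~` O) (open_closedC oO); first by [].
move=> uT [E [entE xOE coarse]].
pose UT := Uniform.Pack uT.
have nE : @nbhs UT UT x (xsection E x) by apply/nbhsP; exists E.
have [V nV clV] := @uniform_regular UT x _ nE.
exists V; first by move: nV; apply: (coarse x).
move=> y clVy; apply: OA; apply: contrapT => nOy.
suff : E (x, y).
  by move=> Exy; have : (set0 : set (T * T)) (x, y) by rewrite -xOE.
apply/xsectionP/clV => W nW; apply: clVy; exact: (coarse y).
Qed.

(** * The space of kappa-complete ultrafilters *)

Section ultrafilter_space.
Variables (K X : Type).

Definition ultrafilter_space :=
  {p : set_system X | UltraFilter p /\ kappa_complete K p}.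

HB.instance Definition _ := gen_eqMixin ultrafilter_space.
HB.instance Definition _ := gen_choiceMixin ultrafilter_space.

Implicit Types (p q : ultrafilter_space) (A B : set X).

Definition hat A : set ultrafilter_space := [set p | sval p A].

Definition uf_nbhs p : set_system ultrafilter_space :=
  [set W | exists2 A, sval p A & hat A `<=` W].

Lemma uf_ultra p : UltraFilter (sval p). Proof. by case: p => p []. Qed.

Lemma uf_complete p : kappa_complete K (sval p). Proof. by case: p => p []. Qed.

Let uf_nbhs_filter p : ProperFilter (uf_nbhs p).
Proof.
have up := uf_ultra p.
apply: Build_ProperFilter_ex => [W [A pA AW]|].
  by exists p; exact: AW.
split=> [|V W [A pA AV] [B pB BW]|V W VW [A pA AV]].
- by exists setT => //; exact: filterT.
- exists (A `&` B); first exact: filterI.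
  move=> q qAB; have uq := uf_ultra q.
  by split; [apply: AV|apply: BW]; apply: filterS qAB => x [].
- by exists A => //; exact: subset_trans AV VW.
Qed.

Let uf_nbhs_singleton p (W : set ultrafilter_space) : uf_nbhs p W -> W p.
Proof. by move=> [A pA]; exact. Qed.

Let uf_nbhs_nbhs p (W : set ultrafilter_space) :
  uf_nbhs p W -> uf_nbhs p (uf_nbhs^~ W).
Proof. by move=> [A pA AW]; exists A => // q qA; exists A. Qed.

HB.instance Definition _ := hasNbhs.Build ultrafilter_space uf_nbhs.
HB.instance Definition _ := Nbhs_isNbhsTopological.Build ultrafilter_space
  uf_nbhs_filter uf_nbhs_singleton uf_nbhs_nbhs.

Let uf_inj p q : sval p = sval q -> p = q.
Proof. by case: p q => [p pP] [q qP] /=; exact: eq_exist. Qed.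

Lemma hatC A : hat (~` A) = ~` hat A.
Proof.
apply/seteqP; split=> p; have up := uf_ultra p; rewrite /hat /= => pA.
  move=> pA'; apply: (@filter_not_empty _ (sval p)).
  by rewrite -(setICr A); exact: filterI.
by have [] := in_ultra_setVsetC A up.
Qed.

Lemma hat_clopen A : clopen (hat A).
Proof.
have oh B : open (hat B) by rewrite openE => p pB; exists B.
by split=> //; rewrite -(setCK A) hatC; exact: open_closedC.
Qed.

Lemma ultrafilter_space_tychonoff : tychonoff_space ultrafilter_space.
Proof.
apply: clopen_base_tychonoff => [p O oO Op|p q pq].
  have [A pA AO] : nbhs p O by exact: open_nbhs_nbhs.
  by exists (hat A); split=> //; exact: hat_clopen.
suff pq' : sval p `<=` sval q.
  apply: uf_inj; have up := uf_ultra p; have uq := uf_ultra q.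
  by symmetry; apply: max_filter.
move=> A pA; have uq := uf_ultra q.
have [//|qA] := in_ultra_setVsetC A uq.
have [r [rA]] : hat A `&` hat (~` A) !=set0.
  by apply: pq; [exists A|exists (~` A)].
by rewrite hatC.
Qed.

(** If the open cover U has no small subcover, neither has the family W of the
    sets A such that [hat A] lies in a member of U, so the small intersections
    of complements of members of W generate a proper filter G; regularity of
    kappa makes G kappa-complete. An ultrafilter extending G escapes U. *)
Lemma ultrafilter_space_lindelof : infinite_set [set: K] ->
  kappa_regular K -> strongly_compact K -> kappa_lindelof K ultrafilter_space.
Proof.
move=> Kinf regK sc U Uo Ucov; apply: contrapT => nV.
pose W := [set A | exists2 O, U O & hat A `<=` O].
pose G : set_system X := [set B | exists V, [/\ V `<=` W, card_lt V [set: K] &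
  \bigcap_(A in V) ~` A `<=` B] ].
have cG : kappa_complete K G.
  move=> U0 U0G ltU0.
  have /choice[V VP] : forall B, exists V, G B ->
      [/\ V `<=` W, card_lt V [set: K] & \bigcap_(A in V) ~` A `<=` B].
    by move=> B; have [[V VB]|nG] := pselect (G B); [exists V|exists set0].
  exists (\bigcup_(B in U0) V B); split.
  - by move=> A [B /U0G /VP[+ _ _]]; apply.
  - by apply: regK => // B /U0G /VP[].
  - move=> x Vx B U0B; have [_ _] := VP B (U0G _ U0B); apply=> A VA.
    by apply: Vx; exists B.
have FG : Filter G.
  apply: (kappa_complete_filter Kinf cG) => A B AB [V [VW ltV VA]].
  by exists V; split=> //; exact: subset_trans AB.
have PG : ProperFilter G.
  split=> // -[V [VW ltV V0]]; apply: nV.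
  have /choice[f fP] : forall A, exists O, V A -> U O /\ hat A `<=` O.
    move=> A; have [/VW[O UO AO]|nVA] := pselect (V A); last by exists set0.
    by exists O.
  exists (f @` V); split.
  - by move=> _ [A /fP[? _] <-].
  - apply/seteqP; split=> // p _; have up := uf_ultra p.
    apply: contrapT => nfp; apply: (@filter_not_empty _ (sval p)).
    apply: filterS V0 _.
    apply: (kappa_complete_bigcap (@uf_complete p)) => // A VA.
    have : hat (~` A) p; last by [].
    rewrite hatC => pA; apply: nfp; exists (f A); first by exists A.
    by have [_] := fP A VA; exact.
  - exact: card_le_lt_trans (card_image_le _ _) ltV.
have [p [up cp Gp]] := sc X G PG cG.
pose q : ultrafilter_space := exist _ p (conj up cp).
have [O UO Oq] : (\bigcup_(O in U) O) q by rewrite Ucov.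
have [A qA AO] : nbhs q O by apply: open_nbhs_nbhs; split=> //; exact: Uo.
have : hat (~` A) q.
  apply: Gp; exists [set A]; split.
  - by move=> _ ->; exists O.
  - by apply: finite_card_lt => //; exact: finite_set1.
  - by rewrite bigcap_set1.
by rewrite hatC.
Qed.

Lemma principal_kappa_complete (x : X) : kappa_complete K (principal_filter x).
Proof.
by move=> U0 U0x _; apply/principal_filterP => A /U0x /principal_filterP.
Qed.

Definition principal_point (x : X) : ultrafilter_space :=
  exist _ (principal_filter x)
    (conj (principal_filter_ultra x) (principal_kappa_complete (x := x))).

Lemma hat_principal_point A x : hat A (principal_point x) = A x.
Proof. by apply/propext; exact: principal_filterP. Qed.

End ultrafilter_space.

(** The extension of f sends p to the limit of the image of p under f; it is
    continuous because Y is regular, and unique because an ultrafilter p is the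
    limit, in the space of ultrafilters, of its own image by
    [principal_point]. *)
Lemma ultrafilter_space_functorial (K : Type) (X : discreteTopologicalType) :
  infinite_set [set: K] -> strongly_compact K ->
  is_functorial_lindelofification K (@principal_point K X).
Proof.
move=> Kinf sc; have regK := strongly_compact_regular Kinf sc.
split.
- exact: ultrafilter_space_tychonoff.
- exact: ultrafilter_space_lindelof.
- move=> x W [A /principal_filterP Ax AW].
  rewrite nbhs_principalE; apply/principal_filterP; apply: AW.
  by rewrite hat_principal_point.
move=> Y tY linY f _; have hY := tY.2.
have /choice[g gP] : forall p : ultrafilter_space K X, exists y : Y,
    f @ sval p --> y.
  move=> p; have up := uf_ultra p.
  have cfp : kappa_complete K (f @ sval p).
    move=> U0 U0p ltU0; rewrite /= nbhs_filterE /fmap /= preimage_bigcap.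
    by apply: (kappa_complete_bigcap (@uf_complete K X p)).
  have [y clfy] := kappa_lindelof_cluster linY _ cfp.
  exists y => O yO; have [//|fO] := in_ultra_setVsetC (f @^-1` O) up.
  by have [z [nOz Oz]] := clfy (~` O) O fO yO; case: nOz.
have gf : f = g \o @principal_point K X.
  apply/funext => x; have up := uf_ultra (principal_point K x).
  apply: (cvg_unique hY _ (gP (principal_point K x))).
  by move=> O /nbhs_singleton Ofx; apply/principal_filterP.
exists g; split; first split=> //.
  move=> p O pO; have [V pV VO] := tychonoff_regular tY pO.
  exists (f @^-1` V); first exact: (gP p).
  move=> q qV; apply: VO => W qW; have uq := uf_ultra q.
  have : sval q (f @^-1` (V `&` W)) by apply: filterI => //; exact: (gP q).
  by move=> /filter_ex[x fx]; exists (f x).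
move=> h [ch fh]; apply/funext => p; have up := uf_ultra p.
apply: (cvg_unique hY (gP p)) => O pO; have [A pA AO] := ch p O pO.
apply: filterS pA => x Ax; rewrite fh /=; apply: AO.
by rewrite hat_principal_point.
Qed.

(** * From lindelofifications to complete ultrafilters *)

(** The extending ultrafilter is the trace on S of the neighbourhood filter of
    a cluster point p, in the lindelofification of S, of the image of F. *)
Lemma lindelofification_strongly_compact (K : Type) : infinite_set [set: K] ->
  (forall X : discreteTopologicalType,
    admits_functorial_lindelofification K X) ->
  strongly_compact K.
Proof.
move=> Kinf lin S F PF cF.
pose X : discreteTopologicalType := discrete_topology {classic S}.
have [nuX [i [_ linX _ ext]]] := lin X.
have ciF : kappa_complete K ((i : S -> nuX) @ F).
  move=> U0 U0F ltU0; rewrite /= nbhs_filterE /fmap /= preimage_bigcap.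
  by apply: (kappa_complete_bigcap cF).
have [p clp] := kappa_lindelof_cluster linX _ ciF.
pose U : set_system S := [set A | exists2 O, nbhs p O & i @^-1` O `<=` A].
(* the extension g of f takes the value g p on a whole neighbourhood of p *)
have fibre (D : discreteTopologicalType) (f : S -> D) :
    card_lt [set: D] [set: K] -> exists d, U (f @^-1` [set d]).
  move=> ltD.
  have cf : continuous (f : X -> D).
    by move=> x W /nbhs_singleton Wfx; rewrite /nbhs/=; apply/principal_filterP.
  have [g [[cg fg] _]] := ext D (discrete_tychonoff D)
    (discrete_kappa_lindelof ltD) f cf.
  exists (g p), (g @^-1` [set g p]).
    by apply: cg; exact: discrete_set1.
  by move=> x /= <-; rewrite fg.
have FU : Filter U.
  split=> [|A B [O pO OA] [O' pO' OB]|A B AB [O pO OA]].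
  - by exists setT => //; exact: filterT.
  - by exists (O `&` O'); [exact: filterI|move=> x [/OA ? /OB]].
  - by exists O => //; exact: subset_trans AB.
have FUI A B : F A -> U B -> A `&` B !=set0.
  move=> FA [O pO OB].
  have FiA : F (i @^-1` (i @` A)) by apply: filterS FA; exact: preimage_image.
  have [_ [[x Ax <-] Ox]] : i @` A `&` O !=set0 by exact: clp.
  by exists x; split=> //; exact: OB.
have PU : ProperFilter U.
  split=> // U0; have [x []//] := FUI setT set0 filterT U0.
(* the fibres of the indicator function of A are A and its complement *)
have Uultra A : U A \/ U (~` A).
  have [|[] Ub] := fibre bool (fun x => `[< A x >]).
  - by apply: finite_card_lt => //; exact: finite_finset.
  - by left; apply: filterS Ub => x /asboolP.
  - by right; apply: filterS Ub => x /asboolP.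
exists U; split; first exact: dichotomy_ultra.
- move=> U0 U0U ltU0.
  have [//|UC] := Uultra (\bigcap_(A in U0) A).
  have [[a0 Ua0]|/nonemptyPn->] := pselect (U0 !=set0); last first.
    by rewrite bigcap_set0; exact: filterT.
  (* f sends a point outside the intersection to a member of U0 avoiding it *)
  pose D : discreteTopologicalType := discrete_topology {classic {A | U0 A}}.
  have /choice[f fP] : forall x : S, exists d : D,
      ~ (\bigcap_(A in U0) A) x -> ~ sval d x.
    move=> x; have [Ux|] := pselect ((\bigcap_(A in U0) A) x).
      by exists (exist _ a0 Ua0).
    by move=> /existsNP[A /not_implyP[UA nAx]]; exists (exist _ A UA).
  have [|d Ud] := fibre D f.
    apply: card_le_lt_trans ltU0.
    have [h] : $|{injfun [set: D] >-> U0}|.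
      apply/injfunPex; exists sval => [A _|A B _ _]; first exact: svalP.
      by case: A B => [A UA] [B UB] /=; exact: eq_exist.
    exact: inj_card_le h.
  exfalso; apply: (@filter_not_empty _ U).
  have UA := U0U _ (svalP d).
  apply: filterS (filterI (filterI UC Ud) UA) => x [[nx fx] dx].
  by apply: (fP x) => //; rewrite fx.
- move=> A FA; have [//|UC] := Uultra A.
  by have [x []] := FUI A (~` A) FA UC.
Qed.

Theorem theorem4p11 (K : Type) (K_infinite : infinite_set [set: K]%classic) :
  strongly_compact K <->
  (forall X : discreteTopologicalType, admits_functorial_lindelofification K X).
Proof.
split=> [sc X|]; last exact: lindelofification_strongly_compact.
by exists (ultrafilter_space K X), (@principal_point K X);
  exact: ultrafilter_space_functorial.
Qed.
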